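(* Let $(R,\mathfrak m)$ be a complete local Noetherian domain of mixed characteristic $p>0$, let $p,x_2,\ldots,x_d$ be a system of parameters of $R$, and let $B$ be a weakly almost Cohen-Macaulay $R^+$-algebra such that: (i) $(p,x_2,\ldots,x_d)B\neq B$; (ii) $x_2,\ldots,x_d$ forms a regular sequence on $B/pB$; (iii) $p$ is not nilpotent in $B$, and the ideal $(0:_Bp)$ is annihilated by $p^{\epsilon}$ for every rational $\epsilon>0$. Assume that $p^{\epsilon}\notin(p,x_2,\ldots,x_d)B$ for some rational $\epsilon>0$. Then $B$ maps, as an $R^+$-algebra, to a big Cohen-Macaulay $R^+$-algebra. In particular, the Monomial Conjecture holds for any ring $T$ with $R\subseteq T\subseteq R^+$; that is, for every system of parameters $y_1,\ldots,y_d$ of $T$ and every $t\in\mathbb N$, $y_1^t\cdots y_d^t\notin(y_1^{t+1},\ldots,y_d^{t+1})T$.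
   Context: A domain $A$ has mixed characteristic $p>0$ if $A$ has characteristic zero while $A/pA$ has characteristic $p>0$. $R^+$ is the integral closure of $R$ in an algebraic closure of its field of fractions. For a rational $\epsilon=m/n>0$ ($m,n$ positive integers), $p^{\epsilon}$ denotes an element of $R^+$ with $(p^{\epsilon})^n=p^m$. A sequence $y_1,\ldots,y_n$ is regular on a module $N$ if $(y_1,\ldots,y_n)N\neq N$ and $y_k$ is a nonzero divisor on $N/(y_1,\ldots,y_{k-1})N$ for all $1\le k\le n$. A big Cohen-Macaulay $R^+$-algebra here is an $R^+$-algebra $C$ with $\mathfrak mC\ne C$ on which the system of parameters $p,x_2,\ldots,x_d$ is a regular sequence (no finiteness is required). Weakly almost Cohen-Macaulay: fix a discrete valuation $v:R\to\mathbb Z\cup\{\infty\}$, non-negative on $R$ and strictly positive on $\mathfrak m$, and an extension of it to a valuation $v:R^+\to\mathbb Q\cup\{\infty\}$. An $R^+$-algebra $B$ is weakly almost Cohen-Macaulay if $\mathfrak mB\neq B$ and there is a system of parameters $y_1,\ldots,y_d$ of $R$ such that for every rational $\epsilon>0$ there exists $b\in R^+$ with $v(b)<\epsilon$ and $b\cdot\frac{(y_1,\ldots,y_i)B:_By_{i+1}}{(y_1,\ldots,y_i)B}=0$ for all $0\le i\le d-1$. A ring $T$ with $R\subseteq T\subseteq R^+$ is a local domain of dimension $d=\dim R$; a system of parameters of $T$ is a sequence of $d$ elements generating an ideal whose radical is the maximal ideal of $T$. *)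

(* Defs.v *)
From HB Require Import structures.
From mathcomp Require Import all_boot all_order all_algebra.
From mathcomp Require Import boolp classical_sets constructive_ereal.

Set Implicit Arguments.
Unset Strict Implicit.
Unset Printing Implicit Defensive.

Import Order.TTheory GRing.Theory Num.Theory.

Local Open Scope classical_set_scope.
Local Open Scope ring_scope.

Section Ideals.
Variable A : comNzRingType.
Implicit Types (I : set A) (s : seq A).

Definition is_ideal I :=
  [/\ I 0, forall x y, I x -> I y -> I (x + y) & forall a x, I x -> I (a * x)].

Definition ideal_gen (X : set A) : set A := smallest is_ideal X.

Definition prime_ideal (P : set A) :=
  [/\ is_ideal P, P <> setT & forall x y, P (x * y) -> P x \/ P y].

Definition maximal_ideal I :=
  [/\ is_ideal I, I <> setT
    & forall J, is_ideal J -> J <> setT -> I `<=` J -> J = I].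

Definition radical I : set A := [set x | exists n, I (x ^+ n)].

Definition ideal_pow I (n : nat) : set A :=
  ideal_gen [set x | exists2 y : 'I_n -> A,
                       forall i, I (y i) & x = \prod_(i < n) y i].

Definition colon I (y : A) : set A := [set z | I (z * y)].

Definition noetherian :=
  forall I, is_ideal I -> exists s, I = ideal_gen [set` s].

Definition local_ring (m : set A) :=
  maximal_ideal m /\ forall I, maximal_ideal I -> I = m.

(* The canonical map from A to the inverse limit of the A / I^n is injective
   and surjective; an element of the limit is given by representatives u n. *)
Definition adic_complete I :=
  (forall x, (forall n, ideal_pow I n x) -> x = 0) /\
  (forall u : nat -> A, (forall n, ideal_pow I n (u n.+1 - u n)) ->
     exists l, forall n, ideal_pow I n (l - u n)).

Definition prime_chain (n : nat) (P : nat -> set A) :=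
  (forall i, (i <= n)%N -> prime_ideal (P i)) /\
  (forall i, (i < n)%N -> P i `<` P i.+1).

Definition krull_dim (d : nat) :=
  (exists P, prime_chain d P) /\ (forall n P, prime_chain n P -> (n <= d)%N).

(* m stands for the maximal ideal of A. The number d is a separate argument
   because for rings between R and R^+ it is the dimension of R. *)
Definition system_of_parameters (m : set A) (d : nat) s :=
  size s = d /\ radical (ideal_gen [set` s]) = m.

(* s is a regular sequence on the module A / J, for an ideal J: the submodule
   (s_1, ..., s_k)(A / J) corresponds to the ideal J + (s_1, ..., s_k). *)
Definition regular_mod (J : set A) s :=
  ideal_gen (J `|` [set` s]) <> setT /\
  (forall k, (k < size s)%N -> forall z,
     ideal_gen (J `|` [set` take k s]) (s`_k * z) ->
     ideal_gen (J `|` [set` take k s]) z).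

Definition regular s := regular_mod [set 0] s.

(* The last condition says that the kernel of Z -> A / pA is pZ. *)
Definition mixed_characteristic (p : nat) :=
  [/\ prime p, [pchar A] =i pred0
    & forall n : nat, ideal_gen [set p%:R] n%:R <-> (p %| n)%N].

(* c is a choice of a^eps *)
Definition rat_power (a : A) (eps : rat) (c : A) :=
  exists m n : nat,
    [/\ (0 < m)%N, (0 < n)%N, eps = m%:R / n%:R & c ^+ n = a ^+ m].

(* The value -oo of \bar G is excluded, so v takes values in G with +oo. *)
Definition valuation (G : numDomainType) (v : A -> \bar G) :=
  [/\ forall x, v x <> -oo%E,
      forall x, v x = +oo%E <-> x = 0,
      forall x y, v (x * y) = (v x + v y)%E
    & forall x y, (Order.min (v x) (v y) <= v (x + y)%R)%E].

End Ideals.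

Section AbsoluteIntegralClosure.
Variables (R : idomainType) (L : closedFieldType).
Variable phi : {rmorphism {fraction R} -> L}.

Definition is_alg_closure := forall z : L, algebraicOver phi z.

Definition frac_map : {rmorphism R -> L} := phi \o @tofrac R.

Definition integral_pred : {pred L} := fun z => `[< integralOver frac_map z >].

Lemma integral_predP z : reflect (integralOver frac_map z) (z \in integral_pred).
Proof. exact: asboolP. Qed.

Fact integral_subring_closed : subring_closed integral_pred.
Proof.
split=> [|x y /integral_predP hx /integral_predP hy
         |x y /integral_predP hx /integral_predP hy]; apply/integral_predP.
- exact: integral1.
- exact: integral_sub.
- exact: integral_mul.
Qed.

HB.instance Definition _ :=
  GRing.isSubringClosed.Build L integral_pred integral_subring_closed.

(* R^+, the integral closure of R in L *)
Record rplus := RPlus {rplus_val : L; rplus_valP : rplus_val \in integral_pred}.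

HB.instance Definition _ := [isSub for rplus_val].
HB.instance Definition _ := [Choice of rplus by <:].
HB.instance Definition _ := [SubChoice_isSubComNzRing of rplus by <:].

Fact in_rplus_subproof (r : R) : frac_map r \in integral_pred.
Proof. by apply/integral_predP; exact: integral_id. Qed.

Definition in_rplus (r : R) : rplus := RPlus (in_rplus_subproof r).

Fact in_rplus_is_zmod_morphism : zmod_morphism in_rplus.
Proof. by move=> x y; apply: val_inj; rewrite /= !rmorphB. Qed.

Fact in_rplus_is_monoid_morphism : monoid_morphism in_rplus.
Proof.
by split=> [|x y]; apply: val_inj; rewrite /= ?rmorph1 ?rmorphM.
Qed.

HB.instance Definition _ :=
  GRing.isZmodMorphism.Build R rplus in_rplus in_rplus_is_zmod_morphism.
HB.instance Definition _ :=
  GRing.isMonoidMorphism.Build R rplus in_rplus in_rplus_is_monoid_morphism.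

Definition in_ralg (B : comAlgType rplus) (r : R) : B := (in_rplus r)%:A.

(* The ideals mB and (s_1, ..., s_n)B, for m a subset and s a sequence of
   elements of R *)
Definition ext_ideal (B : comAlgType rplus) (m : set R) : set B :=
  ideal_gen (in_ralg B @` m).
#[global] Arguments ext_ideal : clear implicits.

Definition ext_seq (B : comAlgType rplus) (s : seq R) : set B :=
  ext_ideal B [set` s].
#[global] Arguments ext_seq : clear implicits.

(* v is a discrete valuation on R, and w extends it to R^+. *)
Definition valuation_extension (m : set R) (v : R -> \bar int)
    (w : rplus -> \bar rat) :=
  [/\ valuation v,
      forall r, (0 <= v r)%E,
      forall r, m r -> (0 < v r)%E,
      valuation w
    & forall r, w (in_rplus r) = er_map intr (v r)].

Definition weakly_almost_CM (m : set R) (d : nat) (w : rplus -> \bar rat)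
    (B : comAlgType rplus) :=
  ext_ideal B m <> setT /\
  exists2 y : seq R, system_of_parameters m d y &
    forall eps : rat, 0 < eps ->
      exists2 b : rplus, (w b < eps%:E)%E &
        forall i, (i < d)%N -> forall z : B,
          colon (ext_seq B (take i y)) (in_ralg B y`_i) z ->
          ext_seq B (take i y) (b *: z).

(* s is the system of parameters that is required to be regular. *)
Definition big_CM (m : set R) (s : seq R) (C : comAlgType rplus) :=
  ext_ideal C m <> setT /\ regular (map (in_ralg C) s).

End AbsoluteIntegralClosure.

Arguments ext_ideal {R L phi} B m _.
Arguments ext_seq {R L phi} B s _.

(* The Monomial Conjecture for A, where m is the maximal ideal of A and d its
   dimension. *)
Definition monomial_property (A : comNzRingType) (m : set A) (d : nat) :=
  forall ys : seq A, system_of_parameters m d ys ->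
    forall t : nat, ~ ideal_gen [set` [seq y ^+ t.+1 | y <- ys]]
                        (\prod_(y <- ys) y ^+ t).

(* Main.v *)
(* Let e_n = p^(1/(n+1)). The big Cohen-Macaulay algebra is the localization C of
   the ring of all sequences in B at the sequence (e_n): the p-torsion of B is
   killed by every e_n, hence vanishes in C, and the regularity of x_2, ..., x_d on
   B/pB passes to sequences and to localizations. If (p, x)C = C, then for some j
   all the powers e_n^j lie in (p, x)B; but e_n^j divides p^eps for large n.

   For the Monomial Conjecture, p, x is a regular sequence on C lying in the
   radical of (y)C, so the Koszul complex of y on C is acyclic in positive degrees
   by depth sensitivity, and this remains true when some of the y_i are replaced
   by powers. Hence y_1^t ... y_d^t in (y_1^(t+1), ..., y_d^(t+1))C would give
   (y)C = C. This is impossible because each y_i is nilpotent modulo mT: by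
   completeness of R, an idempotent of R[X]/(f, m), for an integral equation f of
   y_i, lifts to R[X]/(f), and the domain T has no nontrivial idempotents. *)

Require Import Defs.
From HB Require Import structures.
From mathcomp Require Import all_boot all_order all_algebra ring zify.
From mathcomp Require Import boolp classical_sets constructive_ereal functions.

Set Implicit Arguments.
Unset Strict Implicit.
Unset Printing Implicit Defensive.

Import Order.TTheory GRing.Theory Num.Theory.
Import Pdiv.CommonRing Pdiv.RingMonic.

Local Open Scope classical_set_scope.
Local Open Scope ring_scope.

(** * Ideals, generators and radicals *)

Section IdealTheory.
Variable A : comNzRingType.
Implicit Types (I J X Y : set A) (s : seq A).

Lemma idealN I x : is_ideal I -> I x -> I (- x).
Proof. by move=> [_ _ hM] hx; rewrite -mulN1r; exact: hM. Qed.

Lemma idealB I x y : is_ideal I -> I x -> I y -> I (x - y).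
Proof. by move=> hI hx hy; have [_ hD _] := hI; apply: hD => //; exact: idealN. Qed.

Lemma ideal_sum I (T : Type) (r : seq T) (P : pred T) (F : T -> A) :
  is_ideal I -> (forall i, P i -> I (F i)) -> I (\sum_(i <- r | P i) F i).
Proof. by move=> [h0 hD _] hF; elim/big_ind: _. Qed.

Lemma ideal_gen_ideal X : is_ideal (ideal_gen X).
Proof.
split=> [I [[]] //|x y hx hy I hI|a x hx I hI].
  by have [[_ hD _] _] := hI; apply: hD; [exact: hx|exact: hy].
by have [[_ _ hM] _] := hI; apply: hM; exact: hx.
Qed.

Lemma ideal_gen_sub X : X `<=` ideal_gen X.
Proof. exact: sub_gen_smallest. Qed.

Lemma ideal_gen_min X I : is_ideal I -> X `<=` I -> ideal_gen X `<=` I.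
Proof. by move=> hI hX; exact: smallest_sub. Qed.

Lemma ideal_genS X Y : X `<=` Y -> ideal_gen X `<=` ideal_gen Y.
Proof.
move=> h; apply: ideal_gen_min (ideal_gen_ideal _) _.
exact: subset_trans h (@ideal_gen_sub _).
Qed.

Lemma ideal_gen0 : ideal_gen (set0 : set A) = [set 0].
Proof.
apply/seteqP; split.
  by apply: ideal_gen_min => //; split=> [//|x y -> ->|a x ->];
     rewrite /= ?addr0 ?mulr0.
by move=> _ ->; have [] := ideal_gen_ideal set0.
Qed.

Lemma ideal1 I : is_ideal I -> I 1 -> I = setT.
Proof.
by move=> [_ _ hM] h1; apply/seteqP; split=> // x _; rewrite -[x]mulr1; exact: hM.
Qed.

Lemma ideal_adjoin I y : is_ideal I ->
  is_ideal [set x | exists a, exists2 b, I a & x = a + b * y].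
Proof.
move=> [h0 hD hM]; split=> [|x x' [a [b ha ->]] [a' [b' ha' ->]]|c x [a [b ha ->]]].
- by exists 0, 0; rewrite ?mul0r ?addr0.
- by exists (a + a'), (b + b'); [exact: hD|ring].
- by exists (c * a), (c * b); [exact: hM|ring].
Qed.

(** Splitting off one generator at a time replaces explicit linear combinations and allows induction
    on the list of generators. *)
Lemma ideal_consP y s x :
  ideal_gen [set` y :: s] x <-> exists b, ideal_gen [set` s] (x - b * y).
Proof.
have hs := ideal_gen_ideal [set` s]; split.
  move=> hx; have [a [b ha ->]] :
      [set x | exists a, exists2 b, ideal_gen [set` s] a & x = a + b * y] x.
    apply: ideal_gen_min hx; first exact: ideal_adjoin.
    move=> z; rewrite /= inE => /orP[/eqP->|hz].
      by exists 0, 1; [have [] := hs|ring].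
    by exists z, 0; [exact: ideal_gen_sub|ring].
  by exists b; rewrite addrK.
move=> [b hb]; rewrite -(subrK (b * y) x).
have [_ hD hM] := ideal_gen_ideal [set` y :: s].
apply: hD; first by apply: ideal_genS hb => z hz; rewrite /= inE hz orbT.
by apply: hM; apply: ideal_gen_sub; rewrite /= mem_head.
Qed.

Lemma ideal_gen_perm s s' : s =i s' -> ideal_gen [set` s] = ideal_gen [set` s'].
Proof. by move=> h; congr ideal_gen; apply/seteqP; split=> z /=; rewrite h. Qed.

Lemma sub_radical I : I `<=` radical I.
Proof. by move=> x hx; exists 1%N; rewrite expr1. Qed.

Lemma radicalX I x n : radical I (x ^+ n) -> radical I x.
Proof. by move=> [k hk]; exists (n * k)%N; rewrite exprM. Qed.

Lemma radical_ideal I : is_ideal I -> is_ideal (radical I).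
Proof.
move=> hI; have [h0 hD hM] := hI; split.
- exact: sub_radical.
- move=> x y [n hn] [k hk]; exists (n + k)%N; rewrite exprDn.
  apply: ideal_sum => // i _; rewrite -mulr_natl; apply: (hM).
  have [hik|hik] := leqP k i.
    by rewrite -(subnK hik) exprD mulrA; apply: hM.
  rewrite [_ ^+ _ * _]mulrC; apply: (hM).
  rewrite -(@subnK n (n + k - i)) ?exprD; first exact: hM.
  by rewrite -addnBA ?leq_addr // ltnW.
- by move=> a x [n hn]; exists n; rewrite exprMn; apply: hM.
Qed.

Lemma radical1 I : radical I 1 -> I 1.
Proof. by case=> n; rewrite expr1n. Qed.

Lemma radical_trans X I x :
  is_ideal I -> X `<=` radical I -> radical (ideal_gen X) x -> radical I x.
Proof.
move=> hI hX [n hn]; apply: (@radicalX _ _ n).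
exact: ideal_gen_min (radical_ideal hI) hX _ hn.
Qed.

End IdealTheory.

Lemma ideal_preimage (A A' : comNzRingType) (f : {rmorphism A -> A'}) I :
  is_ideal I -> is_ideal (f @^-1` I).
Proof.
move=> [h0 hD hM]; split=> [|x y|a x] /=; rewrite ?rmorph0 ?rmorphD ?rmorphM //.
- exact: hD.
- exact: hM.
Qed.

Lemma ideal_gen_image (A A' : comNzRingType) (f : {rmorphism A -> A'}) X x :
  ideal_gen X x -> ideal_gen (f @` X) (f x).
Proof.
apply: (ideal_gen_min (ideal_preimage f (ideal_gen_ideal (f @` X)))).
by move=> z hz; apply: ideal_gen_sub; exists z.
Qed.

Lemma image_seq (A A' : choiceType) (f : A -> A') (s : seq A) :
  f @` [set` s] = [set` map f s].
Proof.
apply/seteqP; split=> z /=; first by move=> [y hy <-]; exact: map_f.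
by move=> /mapP[y hy ->]; exists y.
Qed.

Lemma ideal_gen_map (A A' : comNzRingType) (f : {rmorphism A -> A'}) s x :
  ideal_gen [set` s] x -> ideal_gen [set` map f s] (f x).
Proof. by move=> /(@ideal_gen_image _ _ f); rewrite image_seq. Qed.

Lemma radical_map (A A' : comNzRingType) (f : {rmorphism A -> A'}) s x :
  radical (ideal_gen [set` s]) x -> radical (ideal_gen [set` map f s]) (f x).
Proof. by move=> [n hn]; exists n; rewrite -rmorphXn; exact: ideal_gen_map. Qed.

Arguments ideal_gen_map {A A'} f {s x}.
Arguments radical_map {A A'} f {s x}.

(** * Koszul complexes *)

Section Koszul.
Variable A : comNzRingType.

(* The modules of a complex ... -> D 1 -> D 0 -> A with A in degree 0, so that
   [D j] has degree [j.+1]. *)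
Definition term (D : nat -> lmodType A) (j : nat) : lmodType A :=
  if j is i.+1 then D i else A^o.

Record cplx := Cplx {
  mod_ : nat -> lmodType A;
  diff : forall j, {linear mod_ j -> term mod_ j} }.

Local Notation deg K j := (term (mod_ K) j).

(** The mapping cone of multiplication by [x] on [K]. In degree [j.+1] it is the sum of [K] in
    degrees [j.+1] and [j]; in degree 0 it is [A] again, so all cones share the same degree 0. *)
Definition cone_mod (K : cplx) (j : nat) : lmodType A :=
  (mod_ K j * deg K j)%type.

Definition cone_diff (x : A) (K : cplx) j :
    cone_mod K j -> term (cone_mod K) j :=
  match j with
  | 0 => fun u => diff K 0 u.1 + x *: u.2
  | i.+1 => fun u => (diff K i.+1 u.1 + x *: u.2, - diff K i u.2)
  end.

Lemma cone_diff_linear x K j : linear (@cone_diff x K j).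
Proof.
case: j => [|j] a u v /=; rewrite !linearP /=.
  by rewrite scalerDr addrACA.
by congr pair; rewrite /= scalerDr addrACA.
Qed.

HB.instance Definition _ x K j :=
  GRing.isLinear.Build A (cone_mod K j) (term (cone_mod K) j) *:%R
    (@cone_diff x K j) (@cone_diff_linear x K j).

Definition cone x K : cplx := Cplx (fun j => @cone_diff x K j : {linear _ -> _}).

Definition unit_cplx : cplx :=
  @Cplx (fun=> 'rV[A]_0) (fun j => \0%R : {linear _ -> _}).

Definition koszul (s : seq A) : cplx := foldr cone unit_cplx s.

Definition cycle K j : deg K j -> Prop :=
  if j is i.+1 then fun z : mod_ K i => diff K i z = 0 else fun=> True.

Definition boundary K j (z : deg K j) := exists w, z = diff K j w.

(** The index is shifted: this is the vanishing of H_(j+1). Nothing is asked of H_0, which for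
    [koszul s] is [A] modulo the ideal of [s]. *)
Definition exact_at K j := forall z : deg K j.+1, cycle z -> boundary z.

Definition kills K (y : A) := forall j (z : deg K j), cycle z -> boundary (y *: z).

Lemma boundaryD K j (z z' : deg K j) : boundary z -> boundary z' -> boundary (z + z').
Proof. by move=> [u ->] [u' ->]; exists (u + u'); rewrite linearD. Qed.

Lemma boundaryZ K j a (z : deg K j) : boundary z -> boundary (a *: z).
Proof. by move=> [u ->]; exists (a *: u); rewrite linearZ. Qed.

Lemma cycleZ K j a (z : deg K j) : cycle z -> cycle (a *: z).
Proof. by case: j z => //= j z hz; rewrite linearZ_LR /= hz scaler0. Qed.

Lemma kills_ideal K : is_ideal (kills K).
Proof.
split=> [j z hz|y y' hy hy' j z hz|a y hy j z hz].
- by exists 0; rewrite scale0r linear0.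
- by rewrite scalerDl; apply: boundaryD; [exact: hy|exact: hy'].
- by rewrite -scalerA; apply: boundaryZ; exact: hy.
Qed.

Lemma cone_cycle x K j (a : mod_ K j) (b : deg K j) :
  cycle ((a, b) : deg (cone x K) j.+1) <-> diff K j a + x *: b = 0 /\ cycle b.
Proof.
case: j a b => [|j] a b /=; first by split=> [->|[]].
split=> [[h1 h2]|[-> ->]]; last by rewrite oppr0.
by split=> //; apply: oppr_inj; rewrite h2 oppr0.
Qed.

Lemma cone_boundary x K j (a : mod_ K j) (b : deg K j) :
  boundary ((a, b) : deg (cone x K) j.+1) <->
  exists a' b', a = diff K j.+1 a' + x *: b' /\ b = - diff K j b'.
Proof.
split=> [[[a' b'] /= [-> ->]]|[a' [b' [-> ->]]]]; first by exists a', b'.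
by exists (a', b').
Qed.

Lemma koszul_boundary0 s (z : A) :
  @boundary (koszul s) 0 z <-> ideal_gen [set` s] z.
Proof.
elim: s z => [|x s IH] z.
  rewrite (_ : [set` [::]] = set0); last by apply/seteqP; split.
  by rewrite ideal_gen0; split=> [[w ->] //|->]; exists 0.
rewrite ideal_consP; split=> [[[a b] ->]|[b /IH[a ha]]].
  by exists b; rewrite /= [_ *: _]mulrC addrK; apply/IH; exists a.
by exists (a, b); rewrite /= -ha [_ *: _]mulrC subrK.
Qed.

(** From the exact sequence H_(j+2)(K) -> H_(j+2)(cone) -> H_(j+1)(K). *)
Lemma cone_exactS x K j : exact_at K j -> exact_at K j.+1 -> exact_at (cone x K) j.+1.
Proof.
move=> h1 h2 [a b] /cone_cycle[hab /h1[b' hb]]; apply/cone_boundary.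
have [|a' ha] := h2 (a + x *: b').
  by rewrite /= linearD [diff _ _ (x *: _)]linearZ_LR /= -hb.
exists a', (- b'); rewrite scalerN linearN opprK; split=> //.
by rewrite -ha addrK.
Qed.

(** The lowest degree of the same sequence: H_1(cone) maps to the kernel of [x] on H_0, which
    vanishes by the assumption on [x]. *)
Lemma cone_exact0 x s : exact_at (koszul s) 0 ->
  (forall z, ideal_gen [set` s] (x * z) -> ideal_gen [set` s] z) ->
  exact_at (cone x (koszul s)) 0.
Proof.
move=> h hx [a b] /cone_cycle[hab _]; apply/cone_boundary.
have [b' hb] : boundary b.
  apply: (koszul_boundary0 s b).2; apply: hx.
  apply: (koszul_boundary0 s (x * b)).1; exists (- a).
  by rewrite linearN (addr0_eq hab).
have [|a' ha] := h (a + x *: b').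
  by rewrite /= linearD [diff _ _ (x *: _)]linearZ_LR /= -hb.
exists a', (- b'); rewrite scalerN linearN opprK; split=> //.
by rewrite -ha addrK.
Qed.

(** The kernel of [x] on H_j(K) is the image of H_(j+1)(cone). For [j = 0] this yields a
    nonzerodivisor on [A] modulo an ideal. *)
Lemma cone_exact_inj x K j (z : deg K j) : exact_at (cone x K) j ->
  cycle z -> boundary (x *: z) -> boundary z.
Proof.
move=> h hz [w hw].
have [|a' [b' [_ ->]]] := (cone_boundary x (- w) z).1 _.
  by apply: h; apply/cone_cycle; rewrite linearN -hw addNr.
by exists (- b'); rewrite linearN.
Qed.

(** Multiplication by [x] on H_(j+1)(K) is injective by exactness of the cone and nilpotent by
    assumption, so this module is zero. *)
Lemma cone_exact_radical x K j :
  radical (kills K) x -> exact_at (cone x K) j.+1 -> exact_at K j.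
Proof.
move=> [n hn] h z hz; have {hn} := hn _ z hz.
elim: n => [|n IH]; first by rewrite expr0 scale1r.
rewrite exprS -scalerA => /(cone_exact_inj h) h'.
by apply/IH/h'/cycleZ.
Qed.

(** Multiplication by [x] is null-homotopic on the cone, through [(a, b)] sent to [(0, a)]. *)
Lemma kills_cone_head x K : kills (cone x K) x.
Proof.
case=> [|j] z hz; first by exists (0, z); rewrite /= linear0 add0r.
case: z hz => a b /cone_cycle[hab _]; apply/cone_boundary.
exists 0, a; rewrite linear0 add0r; split=> //.
by rewrite (addr0_eq hab).
Qed.

(** The homology of the cone lies between two homology modules of [K], each killed by [y]; hence the
    square. Only radicals matter later, so this loss is harmless. *)
Lemma kills_cone x K y : kills K y -> kills (cone x K) (y * y).
Proof.
move=> hy [|j] z hz.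
  rewrite -scalerA; apply: boundaryZ; have [w hw] := hy 0%N z I.
  by exists (w, 0); rewrite /= scaler0 addr0.
case: z hz => a b /cone_cycle[hab hb].
have [b' hb'] := hy _ _ hb.
have [|a' ha'] := hy j.+1 (y *: a + x *: b').
  by rewrite /= linearD !linearZ_LR /= -hb' scalerA mulrC -scalerA -scalerDr hab scaler0.
apply/cone_boundary; exists a', (- (y *: b')); split.
  by rewrite -ha' scalerDr scalerN !scalerA [x * y]mulrC addrK.
by rewrite linearN opprK [diff _ _ _]linearZ_LR /= -hb' scalerA.
Qed.

Lemma koszul_kills s : [set` s] `<=` radical (kills (koszul s)).
Proof.
elim: s => [//|x s IH] y /=; rewrite inE => /orP[/eqP->|/IH[n hn]].
  exact/sub_radical/kills_cone_head.
by exists (n + n)%N; rewrite exprD; exact: kills_cone.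
Qed.

(** * Retracts of complexes and reordering of the Koszul generators *)

Definition deg_map (K K' : cplx) (f : forall j, mod_ K j -> mod_ K' j) j :
    deg K j -> deg K' j :=
  if j is i.+1 then f i else id.

Definition chain_map (K K' : cplx) (f : forall j, mod_ K j -> mod_ K' j) :=
  (forall j, linear (f j)) /\
  (forall j z, diff K' j (f j z) = deg_map f (diff K j z)).

(** A one-sided inverse suffices to carry exactness from [K] to [K']. Through [deg_map], the chain
    maps are the identity in degree 0. *)
Definition retract (K K' : cplx) := exists f g,
  [/\ @chain_map K K' f, @chain_map K' K g & forall j z, f j (g j z) = z].

Lemma deg_map_linear (K K' : cplx) (f : forall j, mod_ K j -> mod_ K' j) j :
  chain_map f -> linear (@deg_map K K' f j).
Proof. by move=> [h _]; case: j. Qed.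

Lemma retract_exact K K' j : retract K K' -> exact_at K j -> exact_at K' j.
Proof.
move=> [f [g [[_ hf] hg hfg]]] h z hz.
have [|w hw] := h (g j z).
  rewrite /= hg.2 hz; have := @deg_map_linear _ _ _ j hg.
  by move=> /(_ (-1) 0 0); rewrite scaler0 addr0 scaleN1r addNr.
by exists (f _ w); rewrite hf -hw /= hfg.
Qed.

Lemma retract_refl K : retract K K.
Proof. by exists (fun=> id), (fun=> id); split=> //; split=> // -[|j]. Qed.

Lemma retract_trans K K' K'' : retract K K' -> retract K' K'' -> retract K K''.
Proof.
move=> [f [g [[f1 f2] [g1 g2] fg]]] [f' [g' [[f1' f2'] [g1' g2'] fg']]].
exists (fun j z => f' j (f j z)), (fun j z => g j (g' j z)).
split=> [||j z]; last by rewrite fg fg'.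
- split=> [j a u v|[|j] z]; first by rewrite f1 f1'.
    by rewrite f2' f2.
  by rewrite f2' f2.
- split=> [j a u v|[|j] z]; first by rewrite g1' g1.
    by rewrite g2 g2'.
  by rewrite g2 g2'.
Qed.

Lemma cone_chain_map x (K K' : cplx) (f : forall j, mod_ K j -> mod_ K' j) :
  chain_map f ->
  @chain_map (cone x K) (cone x K') (fun j z => (f j z.1, deg_map f z.2)).
Proof.
move=> hf; have hl i := @deg_map_linear _ _ _ i hf; split=> [j a u v|j [a b]].
  by rewrite /= hf.1 hl.
have hx i (u v : deg K i) : deg_map f (u + x *: v) = deg_map f u + x *: deg_map f v.
  by rewrite addrC hl addrC.
have hN i (u : deg K i) : deg_map f (- u) = - deg_map f u.
  have := hl i (-1) u 0; rewrite addr0 !scaleN1r => ->.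
  have := hl i (-1) 0 0; rewrite addr0 scaler0 scaleN1r => ->.
  by rewrite addNr addr0.
case: j a b => [|j] a b /=; first by rewrite hf.2.
congr pair; first by rewrite hf.2; exact: (esym (hx j.+1 _ _)).
by rewrite hf.2 hN.
Qed.

Lemma cone_retract x K K' : retract K K' -> retract (cone x K) (cone x K').
Proof.
move=> [f [g [hf hg hfg]]].
exists (fun j z => (f j z.1, deg_map f z.2)), (fun j z => (g j z.1, deg_map g z.2)).
split=> [||j [a b]]; try exact: cone_chain_map.
by case: j a b => [|j] a b /=; rewrite !hfg.
Qed.

(** The sign on the last component is that of exchanging two exterior generators; this component is
    absent in degree 1. *)
Definition swap_map x y K j :
    mod_ (cone x (cone y K)) j -> mod_ (cone y (cone x K)) j :=
  match j with
  | 0 => fun z => ((z.1.1, z.2), z.1.2)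
  | i.+1 => fun z => ((z.1.1, z.2.1), (z.1.2, - z.2.2))
  end.

Lemma swap_chain_map x y K : chain_map (@swap_map x y K).
Proof.
split=> [[|j] a u v /=|]; first by [].
  by congr (_, (_, _)); rewrite /= scalerN opprD.
case=> [|[|j]] [[a b] c] /=.
- by rewrite addrAC.
- congr pair; last by rewrite scalerN opprD opprK.
  by congr pair; rewrite /= ?scalerN ?opprD // addrAC.
- congr pair; last first.
    congr pair; first by rewrite /= scalerN opprD opprK.
    by rewrite /= [diff _ _ _]linearN.
  by congr pair; rewrite /= ?scalerN ?opprD // addrAC.
Qed.

Lemma swap_retract x y K : retract (cone x (cone y K)) (cone y (cone x K)).
Proof.
exists (@swap_map x y K), (@swap_map y x K).
split; try exact: swap_chain_map.
by case=> [|j] [[a b] c] //=; rewrite opprK -surjective_pairing.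
Qed.

Lemma koszul_retract s x t : retract (koszul (s ++ x :: t)) (koszul (x :: s ++ t)).
Proof.
elim: s => [|y s IH]; first exact: retract_refl.
exact: retract_trans (cone_retract y IH) (swap_retract y x _).
Qed.

(** The list is reversed because [koszul] puts the head of its list in the outermost cone, whereas a
    regular sequence is extended at its end. *)
Lemma koszul_regular s :
  (forall k, (k < size s)%N -> forall z, ideal_gen [set` take k s] (s`_k * z) ->
     ideal_gen [set` take k s] z) ->
  forall j, exact_at (koszul (rev s)) j.
Proof.
elim/last_ind: s => [_ j z _|s x IH h].
  by exists 0; rewrite [z]thinmx0 linear0.
have {}IH : forall j, exact_at (koszul (rev s)) j.
  apply: IH => k hk z; have := h k.
  by rewrite size_rcons ltnS ltnW // nth_rcons hk -cats1 takel_cat 1?ltnW //; apply.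
rewrite rev_rcons => -[|j]; last exact: cone_exactS.
apply: cone_exact0 => // z; have /(_ _)/(_ z) := h (size s).
rewrite size_rcons ltnSn nth_rcons ltnn eqxx -cats1 take_size_cat //.
by rewrite !(ideal_gen_perm (mem_rev s)); apply.
Qed.

(** Each adjoined element, whatever it is, raises the bound for exactness by at most one. *)
Lemma koszul_cat s t i : (forall j, (i <= j)%N -> exact_at (koszul t) j) ->
  forall j, (size s + i <= j)%N -> exact_at (koszul (s ++ t)) j.
Proof.
move=> h; elim: s => [|x s IH] //= [|j] //.
rewrite addSn ltnS => hj; apply: cone_exactS; apply: IH => //.
exact: leqW.
Qed.

(** Conversely, removing an element of the radical lowers the bound by one: some power of it kills
    the homology of the remaining complex, so [cone_exact_radical] applies. *)
Lemma koszul_drop s t i :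
  (forall x, x \in t -> radical (ideal_gen [set` s]) x) ->
  (forall j, (size t + i <= j)%N -> exact_at (koszul (s ++ t)) j) ->
  forall j, (i <= j)%N -> exact_at (koszul s) j.
Proof.
elim: t i => [|x t IH] i hx h; first by rewrite cats0 in h.
apply: IH => [y hy|j hj]; first by apply: hx; rewrite inE hy orbT.
apply: (@cone_exact_radical x).
  have := hx x (mem_head _ _); apply: radical_trans; first exact: kills_ideal.
  move=> y hy; apply: koszul_kills; rewrite /= mem_cat.
  by move: hy => /= ->.
by apply: (retract_exact (koszul_retract _ _ _)); apply: h.
Qed.

(* Both Koszul complexes, of [s] and of [y :: t], are compared with that of the
   concatenation. *)
Lemma radical_nonzerodivisor (s : seq A) y t :
  (forall k, (k < size s)%N -> forall z, ideal_gen [set` take k s] (s`_k * z) ->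
     ideal_gen [set` take k s] z) ->
  size (y :: t) = size s ->
  (forall x, x \in s -> radical (ideal_gen [set` y :: t]) x) ->
  forall z, ideal_gen [set` t] (y * z) -> ideal_gen [set` t] z.
Proof.
move=> hreg hsz hrad z hz.
have h0 : exact_at (koszul (y :: t)) 0.
  (* The bound rises by the length of [y :: t] and falls by that of [s]; the lengths agree, so it
     returns to 0. *)
  apply: (@koszul_drop _ (rev s) 0) => [x|j|//]; first by rewrite mem_rev; exact: hrad.
  rewrite size_rev -hsz addn0 -[size _]addn0; apply: koszul_cat => i _.
  exact: koszul_regular.
apply: (koszul_boundary0 t z).1; apply: (cone_exact_inj h0) => //.
exact: (koszul_boundary0 t (y * z)).2.
Qed.

Lemma regular_monomial (s ys : seq A) t :
  (forall k, (k < size s)%N -> forall z, ideal_gen [set` take k s] (s`_k * z) ->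
     ideal_gen [set` take k s] z) ->
  size ys = size s ->
  (forall x, x \in s -> radical (ideal_gen [set` ys]) x) ->
  ideal_gen [set` [seq y ^+ t.+1 | y <- ys]] (\prod_(y <- ys) y ^+ t) ->
  ideal_gen [set` ys] 1.
Proof.
move=> hreg hsz hrad.
(* The induction lowers the exponents one element at a time: those in [l1] already have exponent 1,
   those in [l2] still have exponent [t.+1]. *)
suff h l1 l2 : size (l1 ++ l2) = size s ->
    (forall x, x \in s -> radical (ideal_gen [set` l1 ++ l2]) x) ->
    ideal_gen [set` l1 ++ [seq y ^+ t.+1 | y <- l2]] (\prod_(y <- l2) y ^+ t) ->
    ideal_gen [set` l1 ++ l2] 1.
  exact: (h [::]).
elim: l2 l1 {hsz hrad ys} => [|y l IH] l1 hsz hrad; first by rewrite big_nil.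
have perm l' : l1 ++ y :: l' =i y :: l1 ++ l' by move=> u; rewrite !(inE, mem_cat) orbCA.
rewrite (ideal_gen_perm (perm l)) in hrad *.
have permX l' : l1 ++ y ^+ t.+1 :: l' =i y ^+ t.+1 :: l1 ++ l'.
  by move=> u; rewrite !(inE, mem_cat) orbCA.
rewrite /= big_cons (ideal_gen_perm (permX _)) ideal_consP => -[b hb].
apply: (IH (y :: l1)) => //; first by rewrite -hsz !size_cat /= addnS.
rewrite cat_cons ideal_consP; exists b.
have {}hb : ideal_gen [set` l1 ++ [seq y ^+ t.+1 | y <- l]]
    (y ^+ t * (\prod_(j <- l) j ^+ t - b * y)).
  by rewrite mulrBr mulrCA -exprSr.
(* Replacing elements by powers keeps the radical, so [y] is still a nonzerodivisor here and the
   factor [y ^+ t] in [hb] can be cancelled. *)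
have hy : forall z, ideal_gen [set` l1 ++ [seq y ^+ t.+1 | y <- l]] (y * z) ->
    ideal_gen [set` l1 ++ [seq y ^+ t.+1 | y <- l]] z.
  apply: (@radical_nonzerodivisor s) => // [|x /hrad].
    by rewrite -hsz /= !size_cat /= size_map addnS.
  apply: radical_trans; first exact: ideal_gen_ideal.
  move=> u; rewrite /= inE mem_cat => /or3P[/eqP->|hu|hu].
  - by apply: sub_radical; apply: ideal_gen_sub; rewrite /= mem_head.
  - by apply: sub_radical; apply: ideal_gen_sub; rewrite /= inE mem_cat hu orbT.
  - exists t.+1; apply: ideal_gen_sub.
    by rewrite /= inE mem_cat (map_f (fun y => y ^+ t.+1) hu) !orbT.
elim: (t in y ^+ t) hb => [|n IHn]; first by rewrite expr0 mul1r.
by rewrite exprS -mulrA => /hy/IHn.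
Qed.

End Koszul.
(** * Lifting idempotents *)

Section IdealPowers.
Variables (A : comNzRingType) (I : set A).
Hypothesis hI : is_ideal I.

Lemma ideal_pow_ideal n : is_ideal (ideal_pow I n).
Proof. exact: ideal_gen_ideal. Qed.

Lemma ideal_pow0 x : ideal_pow I 0 x.
Proof.
have [_ _ hM] := ideal_pow_ideal 0; rewrite -[x]mulr1; apply: hM.
by apply: ideal_gen_sub; exists (fun=> 0) => [[]//|]; rewrite big_ord0.
Qed.

Lemma ideal_powS n x y : I x -> ideal_pow I n y -> ideal_pow I n.+1 (x * y).
Proof.
move=> hx; have [h0 hD hM] := ideal_pow_ideal n.+1.
apply: (@ideal_gen_min _ _ [set y | ideal_pow I n.+1 (x * y)]).
  by split=> [|u v|a u] /=; rewrite ?mulr0 ?mulrDr 1?mulrCA //; [exact: hD|exact: hM].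
move=> _ [u hu ->]; apply: ideal_gen_sub.
exists (fun k => if unlift ord0 k is Some k' then u k' else x).
  by move=> k; case: unliftP => [k'|] _ //; exact: hu.
rewrite big_ord_recl unlift_none; congr (_ * _).
by apply: eq_bigr => k _; rewrite liftK.
Qed.

Lemma ideal_powSW n : ideal_pow I n.+1 `<=` I.
Proof.
apply: ideal_gen_min => // _ [u hu ->].
by have [_ _ hM] := hI; rewrite big_ord_recl mulrC; exact: hM.
Qed.

Lemma ideal_powW n : ideal_pow I n.+1 `<=` ideal_pow I n.
Proof.
apply: ideal_gen_min; first exact: ideal_pow_ideal.
move=> _ [u hu ->]; rewrite big_ord_recl.
have [_ _ hM] := ideal_pow_ideal n; apply: hM.
by apply: ideal_gen_sub; exists (fun k => u (lift ord0 k)).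
Qed.

Lemma ideal_pow1 x : I x -> ideal_pow I 1 x.
Proof. by move=> hx; rewrite -[x]mulr1; apply: ideal_powS => //; exact: ideal_pow0. Qed.

Lemma ideal_powX n x : I x -> ideal_pow I n (x ^+ n).
Proof.
move=> hx; elim: n => [|n IH]; first exact: ideal_pow0.
by rewrite exprS; exact: ideal_powS.
Qed.

(** The inverse is the sum of the geometric series in [a]. *)
Lemma complete_unit a : adic_complete I -> I a -> exists u, u * (1 - a) = 1.
Proof.
move=> [hsep hlim] ha.
have [n|l hl] := hlim (fun n => \sum_(i < n) a ^+ i).
  by rewrite big_ord_recr /= addrAC subrr add0r; exact: ideal_powX.
exists l; apply/eqP; rewrite -subr_eq0; apply/eqP/hsep => n.
have -> : l * (1 - a) - 1 = (1 - a) * (l - \sum_(i < n) a ^+ i) - a ^+ n.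
  by rewrite -[a ^+ n](subrK 1) subrX1; ring.
have [_ _ hM] := ideal_pow_ideal n.
apply: (@idealB _ (ideal_pow I n)); last exact: ideal_powX.
  exact: ideal_pow_ideal.
exact: (hM _ _ (hl n)).
Qed.

Lemma complete_local_unit r : adic_complete I -> maximal_ideal I -> ~ I r ->
  exists u, u * r = 1.
Proof.
move=> hc [_ hI1 hmax] hr; have [h0 hD hM] := hI.
have [[a [b ha e]]|h] := pselect (exists a, exists2 b, I a & 1 = a + b * r).
  have [u hu] := complete_unit hc ha; exists (u * b).
  by rewrite -hu e; ring.
case: hr; rewrite -(hmax _ (ideal_adjoin r hI)).
- by exists 0, 1 => //; ring.
- by move=> e; apply: h; have : setT (1 : A) by []; rewrite -e.
- by move=> x hx; exists x, 0 => //; ring.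
Qed.

End IdealPowers.

(** * Idempotents modulo a monic polynomial *)

Section IdempotentLifting.
Variables (R : comNzRingType) (m : set R) (f : {poly R}).
Hypotheses (hm : is_ideal m) (hc : adic_complete m) (hf : f \is monic).
Implicit Types (I : set R) (g h : {poly R}).

Definition coefs_in I h := forall i, I h`_i.

(** The ideal of [{poly R}] generated by [f] and [I]. *)
Definition poly_mod I h := exists q, coefs_in I (h - q * f).

Lemma coefs_in_ideal I : is_ideal I -> is_ideal (coefs_in I).
Proof.
move=> hI; have [h0 hD hM] := hI.
split=> [i|g h hg hh i|g h hh i]; rewrite ?coef0 ?coefD ?coefM //; first exact: hD.
by apply: ideal_sum => // k _; exact: hM.
Qed.

Lemma poly_mod_ideal I : is_ideal I -> is_ideal (poly_mod I).
Proof.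
move=> /coefs_in_ideal[h0 hD hM].
split=> [|g h [q hq] [r hr]|g h [q hq]].
- by exists 0; rewrite mul0r subr0.
- by exists (q + r); rewrite mulrDl opprD addrACA; exact: hD.
- by exists (g * q); rewrite -mulrA -mulrBr; exact: hM.
Qed.

Lemma poly_mod_dvd I q : is_ideal I -> poly_mod I (q * f).
Proof. by move=> [h0 _ _]; exists q => i; rewrite subrr coef0. Qed.

Lemma coefs_in_mod I h : coefs_in I h -> poly_mod I h.
Proof. by exists 0; rewrite mul0r subr0. Qed.

Lemma poly_modS I J : I `<=` J -> poly_mod I `<=` poly_mod J.
Proof. by move=> hIJ h [q hq]; exists q => i; exact: hIJ. Qed.

Lemma poly_modM k g h : poly_mod m g -> poly_mod (ideal_pow m k) h ->
  poly_mod (ideal_pow m k.+1) (g * h).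
Proof.
move=> [q hq] [r hr]; exists (q * h + g * r - q * r * f) => i.
have -> : g * h - (q * h + g * r - q * r * f) * f = (g - q * f) * (h - r * f) by ring.
rewrite coefM; apply: ideal_sum => [|j _]; first exact: ideal_pow_ideal.
exact: ideal_powS.
Qed.

Lemma rmodp_coefs I h : is_ideal I -> poly_mod I h -> coefs_in I (rmodp h f).
Proof.
move=> hI [q hq]; have [h0 hD hM] := coefs_in_ideal hI.
rewrite -(subrK (q * f) h) rmodpD // rmodp_mull // addr0.
rewrite -[h - _]coefK poly_def rmodp_sum //.
apply: ideal_sum => [|i _]; first exact: coefs_in_ideal.
rewrite rmodpZ // -mul_polyC mulrC; apply: (hM).
by move=> j; rewrite coefC; case: eqP => // _; have [] := hI.
Qed.

Lemma idempotent_lift e0 : poly_mod m (e0 ^+ 2 - e0) ->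
  exists e, (exists q, e ^+ 2 - e = q * f) /\ poly_mod m (e - e0).
Proof.
move=> he0; have [hsep hlim] := hc.
(* Newton iteration for the equation e^2 = e: the new defect is a multiple of the square of the old
   one. *)
pose step e : {poly R} := 3 * e ^+ 2 - 2 * e ^+ 3.
pose e_ k := iter k step e0.
have he k : poly_mod (ideal_pow m k.+1) (e_ k ^+ 2 - e_ k).
  elim: k => [|k IH]; first by apply: poly_modS he0 => y; exact: ideal_pow1.
  have -> : e_ k.+1 ^+ 2 - e_ k.+1 =
      (4 * (e_ k ^+ 2 - e_ k) - 3) * ((e_ k ^+ 2 - e_ k) * (e_ k ^+ 2 - e_ k)).
    by rewrite /e_ iterS -/(e_ k) /step; ring.
  have [_ _ hM] := poly_mod_ideal (ideal_pow_ideal m k.+2); apply: (hM).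
  apply: poly_modM => //; apply: poly_modS IH; exact: ideal_powSW.
have hd k : poly_mod (ideal_pow m k.+1) (e_ k.+1 - e_ k).
  have -> : e_ k.+1 - e_ k = (1 - 2 * e_ k) * (e_ k ^+ 2 - e_ k).
    by rewrite /e_ iterS -/(e_ k) /step; ring.
  by have [_ _ hM] := poly_mod_ideal (ideal_pow_ideal m k.+1); apply: hM.
(* The limit is taken on remainders modulo [f]: their degrees are bounded, so the coefficientwise
   limit is a polynomial. *)
have hl i : exists l, forall n, ideal_pow m n (l - (rmodp (e_ n) f)`_i).
  apply: hlim => n; rewrite -coefB -rmodpB //.
  by apply: ideal_powW; apply: rmodp_coefs; [exact: ideal_pow_ideal|exact: hd].
have [l {}hl] := choice hl.
pose e := \poly_(i < size f) l i.
have hen n : poly_mod (ideal_pow m n) (e - e_ n).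
  have [_ hD _] := poly_mod_ideal (ideal_pow_ideal m n).
  rewrite [X in _ - X](rdivp_eq hf) opprD addrCA -mulNr.
  apply: hD; first exact: poly_mod_dvd (ideal_pow_ideal m n).
  apply: coefs_in_mod => i; rewrite coefB coef_poly; case: ltnP => hi; first exact: hl.
  rewrite [_`_i]nth_default ?subrr; first by have [] := ideal_pow_ideal m n.
  apply: leq_trans hi; apply: ltnW.
  by rewrite ltn_rmodp monic_neq0.
exists e; split.
  exists (rdivp (e ^+ 2 - e) f).
  (* The remainder has its coefficients in every power of [m], hence vanishes by separatedness. *)
  rewrite [LHS](rdivp_eq hf) [X in _ + X](_ : _ = 0) ?addr0 //.
  apply/polyP => i; rewrite coef0; apply: hsep => n.
  apply: rmodp_coefs; first exact: ideal_pow_ideal.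
  have -> : e ^+ 2 - e = (e + e_ n - 1) * (e - e_ n) + (e_ n ^+ 2 - e_ n) by ring.
  have [_ hD hM] := poly_mod_ideal (ideal_pow_ideal m n).
  apply: hD; first exact: hM.
  by apply: poly_modS (he n); exact: ideal_powW.
have -> : e - e0 = (e - e_ 1%N) + (e_ 1%N - e_ 0%N) by rewrite addrA subrK.
apply: (@poly_modS (ideal_pow m 1)); first exact: ideal_powSW.
by have [_ hD hM] := poly_mod_ideal (ideal_pow_ideal m 1); exact: hD.
Qed.

End IdempotentLifting.

(* With [a] minimal such that the coefficient [f`_a] is a unit, [f = 'X^a g]
   modulo [m] and [e0 = ('X s)^(a+1)] is idempotent modulo [(f, m)], where
   ['X s = 1] modulo [g]. Its lift to an idempotent is 0 or 1 at [z]. *)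
Lemma integral_nilpotent (R T : comNzRingType) (m : set R) (i : {rmorphism R -> T})
    (n : set T) (f : {poly R}) (z : T) :
  adic_complete m -> maximal_ideal m ->
  (forall e : T, e ^+ 2 = e -> e = 0 \/ e = 1) ->
  is_ideal n -> n <> setT -> (forall r, m r -> n (i r)) ->
  f \is monic -> root (map_poly i f) z -> n z ->
  radical (ideal_gen (i @` m)) z.
Proof.
move=> hc hmax hT hn hn1 hmn hf /rootP hz hnz.
have hm := let: And3 h _ _ := hmax in h.
set J := ideal_gen _; have hJ : is_ideal J := ideal_gen_ideal _.
have hrJ := radical_ideal hJ.
have hJn : J `<=` n by apply: ideal_gen_min => // _ [r hr <-]; exact: hmn.
pose ev : {rmorphism {poly R} -> T} := horner_eval z \o map_poly i.
have evf : ev f = 0 by [].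
have evX : ev 'X = z by rewrite /ev /= /horner_eval map_polyX hornerX.
have evJ h : coefs_in m h -> J (ev h).
  move=> hh; rewrite /ev /= /horner_eval horner_coef; apply: ideal_sum => // k _.
  have [_ _ hM] := hJ; rewrite mulrC; apply: (hM); apply: ideal_gen_sub.
  by rewrite coef_map; exists h`_k.
have evM h : poly_mod f m h -> J (ev h).
  by move=> [q /evJ]; rewrite rmorphB rmorphM evf mulr0 subr0.
have [a ha hmin] : exists2 a, ~ m f`_a & forall k, (k < a)%N -> m f`_k.
  have hex : exists k, `[< ~ m f`_k >].
    exists (size f).-1; apply/asboolP; rewrite -/(lead_coef f) (monicP hf).
    by move=> /(ideal1 hm); have [] := hmax.
  have [a /asboolP ha hmin] := ex_minnP hex.
  exists a => // k hk; apply: contrapT => /asboolP /hmin.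
  by rewrite leqNgt hk.
have [u hu] := complete_local_unit hm hc hmax ha.
pose g := drop_poly a f; pose s := - (u%:P * drop_poly 1 g).
have hg : u%:P * g = 1 - 'X * s.
  rewrite -[g in LHS](poly_take_drop 1) mulrDr /s mulrN opprK.
  have -> : take_poly 1 g = (f`_a)%:P.
    apply/polyP => k; rewrite coef_take_poly coefC ltnS leqn0 coef_drop_poly.
    by case: eqP => // ->.
  by rewrite -polyCM hu expr1; ring.
have hfg : coefs_in m ('X^a * g - f).
  rewrite -[X in _ - X](poly_take_drop a f) -/g => k.
  have -> : 'X^a * g - (take_poly a f + g * 'X^a) = - take_poly a f by ring.
  rewrite coefN coef_take_poly; apply: idealN => //.
  by case: ltnP => [/hmin|_] //; have [] := hm.
have hJzg : J (z ^+ a * (1 - z * ev s)).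
  have := evJ _ hfg; rewrite rmorphB rmorphM rmorphXn evf subr0 evX => h.
  rewrite -evX -rmorphM -(rmorph1 ev) -rmorphB -hg rmorphM mulrCA evX.
  by have [_ _ hM] := hJ; exact: hM.
have [_ hD hM] := coefs_in_ideal hm.
pose e0 := ('X * s) ^+ a.+1.
have he0 : poly_mod f m (e0 ^+ 2 - e0).
  have hX := subrX1 ('X * s) a.+1.
  set w := \sum_(_ < _) _ in hX.
  (* Here [e0 - 1] is [('X * s - 1) * w], that is [- u%:P * g * w], and [e0] contributes the factor
     ['X^a] that turns [g] into [f] modulo [m]. *)
  exists (- ('X * s ^+ a.+1 * u%:P * w)).
  have -> : e0 ^+ 2 - e0 - - ('X * s ^+ a.+1 * u%:P * w) * f =
      - ('X * s ^+ a.+1 * u%:P * w) * ('X^a * g - f).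
    have -> : e0 ^+ 2 - e0 = e0 * (e0 - 1) by ring.
    rewrite [X in _ * X]hX /e0 exprMn exprS.
    have -> : 'X * s - 1 = - (u%:P * g) by rewrite hg; ring.
    ring.
  exact: hM.
have [e [[q hq] he]] := idempotent_lift hm hc hf he0.
have hJe : J (ev e - (z * ev s) ^+ a.+1).
  by have := evM _ he; rewrite rmorphB rmorphXn rmorphM evX.
have hidem : ev e ^+ 2 = ev e.
  by apply/eqP; rewrite -subr_eq0 -rmorphXn -rmorphB hq rmorphM evf mulr0.
have [_ rD rM] := hrJ.
(* If the idempotent is 0, then [z * ev s] is in the radical of [J], and [hJzg] puts [z ^+ a] there
   too. If it is 1, then 1 is the sum of an element of [J] and a multiple of [z], hence in [n]. *)
have [h0|h1] := hT _ hidem.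
  have hzs : radical J (z * ev s).
    apply: (@radicalX _ J _ a.+1); apply: (@sub_radical _ J).
    by rewrite -[X in J X]opprK; apply: (@idealN _ J) => //; rewrite -[- _]add0r -h0.
  apply: (@radicalX _ J _ a).
  have -> : z ^+ a = z ^+ a * (1 - z * ev s) + z ^+ a * (z * ev s) by ring.
  by apply: rD; [exact: (@sub_radical _ J)|exact: rM].
case: hn1; apply: ideal1 => //.
have -> : 1 = (ev e - (z * ev s) ^+ a.+1) + (z ^+ a * ev s ^+ a.+1) * z.
  by rewrite h1 exprMn exprS; ring.
have [_ nD nM] := hn.
by apply: nD; [exact: hJn|exact: nM].
Qed.
Lemma regularP (A : comNzRingType) (s : seq A) :
  regular s <-> ideal_gen [set` s] <> setT /\
    forall k, (k < size s)%N -> forall z,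
      ideal_gen [set` take k s] (s`_k * z) -> ideal_gen [set` take k s] z.
Proof.
have e (t : seq A) : ideal_gen ([set 0] `|` [set` t]) = ideal_gen [set` t].
  apply/seteqP; split; last by apply: ideal_genS; exact: subsetUr.
  have ht := ideal_gen_ideal [set` t]; apply: ideal_gen_min => //.
  move=> z [->|]; last exact: ideal_gen_sub.
  by have [] := ht.
by rewrite /regular /regular_mod e; split=> -[h1 h2]; split=> // k hk z;
  have := h2 k hk z; rewrite e.
Qed.

(** * Localization at a sequence *)

Section Localization.
Variables (A : comNzRingType) (c : A).
Hypothesis hc : forall j, c ^+ j <> 0.

(** The ideal of [cX - 1]: the quotient of A[X] by it is the localization at the powers of [c],
    nonzero since no power of [c] vanishes. *)
Definition loc_pred : {pred {poly A}} :=
  fun h => `[< exists q, h = ('X * c%:P - 1) * q >].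

(** Comparing coefficients in [b = (cX - 1) q] forces the k-th coefficient of [q] to be
    [- c ^+ k * b], and [q] has only finitely many. *)
Lemma loc_polyC b : b%:P \in loc_pred -> exists j, c ^+ j * b = 0.
Proof.
move=> /asboolP[q hq].
have hk k : q`_k = - (c ^+ k * b).
  elim: k => [|k IH].
    have := congr1 (fun h : {poly A} => h`_0) hq.
    rewrite /= coefC eqxx mulrBl mul1r coefB -mulrA coefXM eqxx sub0r => ->.
    by rewrite expr0 mul1r opprK.
  have := congr1 (fun h : {poly A} => h`_k.+1) hq.
  rewrite /= coefC mulrBl mul1r coefB -mulrA coefXM /= coefCM IH => /eqP.
  by rewrite eq_sym subr_eq0 => /eqP <-; rewrite exprS; ring.
exists (size q); apply: oppr_inj; rewrite -hk oppr0; exact: nth_default.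
Qed.

Fact loc_idealr_closed : idealr_closed loc_pred.
Proof.
split.
- by apply/asboolP; exists 0; rewrite mulr0.
- by apply/negP => /loc_polyC[j]; rewrite mulr1; exact: hc.
- move=> a u v /asboolP[q ->] /asboolP[r ->]; apply/asboolP.
  by exists (a * q + r); ring.
Qed.

#[local] HB.instance Definition _ := isIdealr.Build _ loc_pred loc_idealr_closed.

Definition loc : comNzRingType := {ideal_quot loc_pred}.

Definition pi_loc : {rmorphism {poly A} -> loc} := \pi_{ideal_quot loc_pred}%qT.

Definition to_loc : {rmorphism A -> loc} := pi_loc \o polyC.

Lemma pi_loc_eq0 h : pi_loc h = 0 -> h \in loc_pred.
Proof.
move=> h0; rewrite -[h]subr0 Quotient.idealrBE; apply/eqP.
by rewrite -[LHS]/(pi_loc h) h0 -[RHS]/(pi_loc 0) rmorph0.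
Qed.

Lemma pi_locX : pi_loc 'X * to_loc c = 1.
Proof.
rewrite -rmorphM -(rmorph1 pi_loc); apply/eqP.
rewrite -[_ == _]/(_ == _ %[mod {ideal_quot loc_pred}])%qT -Quotient.idealrBE.
by apply/asboolP; exists 1; rewrite mulr1.
Qed.

Lemma localization_exists :
  exists (C : comNzRingType) (f : {rmorphism A -> C}),
  [/\ exists v, v * f c = 1,
      forall u, exists j b, f c ^+ j * u = f b
    & forall b, f b = 0 -> exists j, c ^+ j * b = 0].
Proof.
exists loc, to_loc; split=> [|u|b /pi_loc_eq0/loc_polyC //].
  by exists (pi_loc 'X); exact: pi_locX.
have [h <-] : exists h, pi_loc h = u.
  by exists (repr u); rewrite /= reprK.
elim/poly_ind: h => [|h a [j [b hb]]].
  by exists 0%N, 0; rewrite expr0 mul1r !rmorph0.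
exists j.+1, (b + c ^+ j.+1 * a).
rewrite (rmorphD pi_loc) (rmorphM pi_loc) mulrDr.
rewrite (rmorphD to_loc) (rmorphM to_loc) (rmorphXn to_loc) -hb.
congr (_ + _); rewrite exprSr mulrACA [X in _ * X]mulrC pi_locX.
by rewrite mulr1.
Qed.

End Localization.

(** * The ring of sequences in [B] *)

Section Pointwise.
Variable B : comNzRingType.

Definition const_seq (b : B) : nat -> B := fun=> b.

Fact const_seq_zmod_morphism : zmod_morphism const_seq.
Proof. by []. Qed.

Fact const_seq_monoid_morphism : monoid_morphism const_seq.
Proof. by []. Qed.

HB.instance Definition _ :=
  GRing.isZmodMorphism.Build B (nat -> B) const_seq const_seq_zmod_morphism.
HB.instance Definition _ :=
  GRing.isMonoidMorphism.Build B (nat -> B) const_seq const_seq_monoid_morphism.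

Definition seq_at (n : nat) (u : nat -> B) : B := u n.

Fact seq_at_zmod_morphism n : zmod_morphism (seq_at n).
Proof. by []. Qed.

Fact seq_at_monoid_morphism n : monoid_morphism (seq_at n).
Proof. by []. Qed.

HB.instance Definition _ n :=
  GRing.isZmodMorphism.Build (nat -> B) B (seq_at n) (seq_at_zmod_morphism n).
HB.instance Definition _ n :=
  GRing.isMonoidMorphism.Build (nat -> B) B (seq_at n) (seq_at_monoid_morphism n).

(** Since [s] is a finite list, the coefficients chosen at each index assemble into finitely many
    sequences. *)
Lemma ideal_pointwise (s : seq B) (u : nat -> B) :
  ideal_gen [set` map const_seq s] u <-> forall n, ideal_gen [set` s] (u n).
Proof.
split=> [hu n|].
  have := ideal_gen_map (seq_at n) hu.
  by rewrite -map_comp (eq_map (g := id)) ?map_id.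
elim: s u => [|y s IH] u hu.
  have e (T : choiceType) : [set` [::]] = set0 :> set T by apply/seteqP; split.
  rewrite /= e ideal_gen0; apply/funext => n.
  by have := hu n; rewrite e ideal_gen0.
have [b hb] := choice (fun n => (ideal_consP y s (u n)).1 (hu n)).
by apply/ideal_consP; exists b; apply: IH => n; exact: hb.
Qed.

End Pointwise.

(* Inverting the sequence [e] in the ring of all sequences turns "killed by every
   [e n]" into "zero". *)
Lemma almost_regular_localization (B : comNzRingType) (e : nat -> B) (s : seq B) :
  (forall k, (k < size s)%N -> forall z,
     ideal_gen [set` take k s] (s`_k * z) ->
     forall n, ideal_gen [set` take k s] (e n * z)) ->
  (forall j, exists n, ~ ideal_gen [set` s] (e n ^+ j)) ->
  exists (C : comNzRingType) (f : {rmorphism B -> C}), regular (map f s).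
Proof.
move=> hs he.
have eX j n : (e ^+ j) n = e n ^+ j by exact: (rmorphXn (seq_at n)).
have hc j : e ^+ j <> 0.
  move=> h; have [n] := he j; apply; rewrite -eX h.
  by have [] := ideal_gen_ideal [set` s].
have [C [f [[v hv] hsurj hker]]] := localization_exists hc.
pose h : {rmorphism B -> C} := f \o @const_seq B.
have hvX j z : v ^+ j * (f e ^+ j * z) = z.
  by rewrite mulrA -exprMn hv expr1n mul1r.
(* Membership in an extended ideal of [C] descends to every entry after multiplication by one power
   of [e], uniform in [n]: first denominators are cleared, then the kernel of [f] is absorbed. *)
have desc t b : ideal_gen [set` map h t] (f b) ->
    exists j, forall n, ideal_gen [set` t] (e n ^+ j * b n).
  set I := ideal_gen [set` map (@const_seq B) t] => hb.
  have [j [b' [hb' heq]]] : [set u | exists j b, I b /\ f e ^+ j * u = f b] (f b).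
    apply: ideal_gen_min hb.
      have [I0 ID IM] := ideal_gen_ideal [set` map (@const_seq B) t].
      split=> [|u u' [j [a [ha hu]]] [j' [a' [ha' hu']]]|u u' [j [a [ha hu]]]].
      - by exists 0%N, 0; rewrite mulr0 rmorph0.
      - exists (j + j')%N, (e ^+ j' * a + e ^+ j * a').
        split; first by apply: ID; exact: IM.
        rewrite rmorphD !rmorphM !rmorphXn -hu -hu' exprD; ring.
      - have [k [d hd]] := hsurj u; exists (k + j)%N, (d * a); split; first exact: IM.
        by rewrite rmorphM -hu -hd exprD; ring.
    move=> _ /= /mapP[y hy ->]; exists 0%N, (const_seq y).
    split; last by rewrite mul1r.
    by apply: ideal_gen_sub; exact: map_f.
  have [|k hk] := hker (e ^+ j * b - b').
    by rewrite rmorphB rmorphM rmorphXn heq subrr.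
  exists (k + j)%N => n; rewrite -eX.
  have -> : (e ^+ (k + j)) n * b n = (e ^+ k * b') n.
    rewrite -[LHS]/((e ^+ (k + j) * b) n); congr (_ n).
    by apply/eqP; rewrite -subr_eq0 exprD -mulrA -mulrBr hk.
  apply: (ideal_pointwise t (e ^+ k * b')).1.
  by have [_ _ IM] := ideal_gen_ideal [set` map (@const_seq B) t]; exact: IM.
exists C, h; apply/regularP; split.
  move=> h1; have [|j hj] := desc s 1.
    by rewrite rmorph1 h1.
  by have [n] := he j; apply; have := hj n; rewrite mulr1.
rewrite size_map => k hk z; rewrite -map_take (nth_map 0) // => hz.
have hI := ideal_gen_ideal [set` map h (take k s)]; have [_ _ IM] := hI.
have [j [b hb]] := hsurj z.
have [|i hi] := desc (take k s) (const_seq s`_k * b).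
  rewrite rmorphM -hb mulrCA; exact: IM.
have {}hi n : ideal_gen [set` take k s] (e n ^+ i.+1 * b n).
  by rewrite exprS -mulrA; apply: hs => //; have := hi n; rewrite mulrCA.
rewrite -(hvX j z) -(hvX i.+1 (f e ^+ j * z)); apply: (IM); apply: (IM).
rewrite hb -rmorphXn -rmorphM map_comp; apply: ideal_gen_map.
by apply/ideal_pointwise => n; rewrite -[_ n]/((e ^+ i.+1) n * b n) eX.
Qed.

(** * Restriction of scalars along a ring morphism *)

Section RestrictionOfScalars.
Variables (S C : comNzRingType) (f : {rmorphism S -> C}).

(* The phantom [f] lets canonical structures find the scalar action. *)
Definition restr : Type := let _ := f in C.

HB.instance Definition _ := GRing.ComNzRing.on restr.

Definition restr_scale (a : S) (u : restr) : restr := f a * (u : C).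

Fact restr_scaleA a b u : restr_scale a (restr_scale b u) = restr_scale (a * b) u.
Proof. by rewrite /restr_scale rmorphM mulrA. Qed.

Fact restr_scale1 : left_id 1 restr_scale.
Proof. by move=> u; rewrite /restr_scale rmorph1 mul1r. Qed.

Fact restr_scaleDr : right_distributive restr_scale +%R.
Proof. by move=> a u v; exact: mulrDr. Qed.

Fact restr_scaleDl u : {morph restr_scale^~ u : a b / a + b}.
Proof. by move=> a b; rewrite /restr_scale rmorphD mulrDl. Qed.

HB.instance Definition _ := GRing.Zmodule_isLmodule.Build S restr
  restr_scaleA restr_scale1 restr_scaleDr restr_scaleDl.

Fact restr_scaleAl (a : S) (u v : restr) : a *: (u * v) = (a *: u) * v.
Proof. exact: mulrA. Qed.

HB.instance Definition _ := GRing.Lmodule_isLalgebra.Build S restr restr_scaleAl.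

Fact restr_scaleAr (a : S) (u v : restr) : a *: (u * v) = u * (a *: v).
Proof. exact: mulrCA. Qed.

HB.instance Definition _ := GRing.Lalgebra_isAlgebra.Build S restr restr_scaleAr.

End RestrictionOfScalars.

(** The ring and the map stay the same; only a scalar action is added, so regularity carries over by
    conversion. *)
Lemma restr_lrmorphism (S C : comNzRingType) (B : comAlgType S) (g : {rmorphism B -> C}) :
  exists (C' : comAlgType S) (h : {lrmorphism B -> C'}),
    forall s : seq B, regular (map g s) -> regular (map h s).
Proof.
pose f : {rmorphism S -> C} := g \o in_alg B.
pose h : B -> restr f := g.
have hl : scalable h.
  by move=> a u; rewrite -mulr_algl; exact: rmorphM.
pose hR : {rmorphism B -> restr f} := g.
exists (restr f : comAlgType S).
pose hL := GRing.isScalable.Build S B (restr f) *:%R h hl.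
by exists (HB.pack_for {lrmorphism B -> restr f} h (GRing.RMorphism.class hR) hL).
Qed.
Lemma ideal_genUl (A : comNzRingType) (X Y : set A) :
  ideal_gen (ideal_gen X `|` Y) = ideal_gen (X `|` Y).
Proof.
apply/seteqP; split; last first.
  by apply: ideal_genS => z [/ideal_gen_sub|]; [left|right].
have hI := ideal_gen_ideal (X `|` Y); apply: ideal_gen_min => // z [|hz].
  by apply: ideal_genS; exact: subsetUl.
by apply: ideal_gen_sub; right.
Qed.

(** * Rings between R and its absolute integral closure *)

Section Rplus.
Variables (R : idomainType) (L : closedFieldType).
Variable phi : {rmorphism {fraction R} -> L}.
Local Notation S := (rplus phi).

Lemma frac_map_eq0 r : (frac_map phi r == 0) = (r == 0).
Proof. by rewrite /= fmorph_eq0 tofrac_eq0. Qed.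

Lemma integral_root (z : L) k r : (0 < k)%N -> z ^+ k = frac_map phi r ->
  z \in integral_pred phi.
Proof.
move=> hk hz; apply/integral_predP; exists ('X^k - r%:P); first exact: monicXnsubC.
by rewrite rmorphB /= map_polyXn map_polyC /root !hornerE /= hz subrr.
Qed.

(** The chosen roots need not be compatible, but the quotient of [b] by [a ^+ j] in [L] has a
    positive power that is a nonnegative power of [r]; it is therefore integral. *)
Lemma rat_power_dvd (r : R) (a b : S) n j eps : r != 0 ->
  rat_power (in_rplus phi r) n.+1%:R^-1 a -> rat_power (in_rplus phi r) eps b ->
  j%:R * n.+1%:R^-1 <= eps -> exists q, b = a ^+ j * q.
Proof.
move=> hr [k [l [hk hl hkl ha]]] [M [N [hM hN -> hb]]] hj.
have hl' : l = (k * n.+1)%N.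
  apply/eqP; rewrite -(eqr_nat rat) natrM.
  have hn0 : n.+1%:R != 0 :> rat by rewrite pnatr_eq0.
  have hl0 : l%:R != 0 :> rat by rewrite pnatr_eq0 -lt0n.
  by rewrite -[k%:R](divfK hl0) -hkl mulrAC mulVf // mul1r.
have hle : (j * N <= M * n.+1)%N.
  move: hj; rewrite ler_pdivlMr ?ltr0n // mulrAC ler_pdivrMr ?ltr0n //.
  by rewrite -!natrM ler_nat.
have {}hle : (k * j * N <= M * l)%N by rewrite hl'; nia.
pose v : {rmorphism S -> L} := val.
have va : v a ^+ l = frac_map phi r ^+ k by rewrite -rmorphXn ha rmorphXn.
have vb : v b ^+ N = frac_map phi r ^+ M by rewrite -rmorphXn hb rmorphXn.
have r0 : frac_map phi r != 0 by rewrite frac_map_eq0.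
have a0 : v a != 0.
  apply/eqP => h; move: va; rewrite h expr0n (gtn_eqF hl) => /esym/eqP.
  by rewrite expf_eq0 (negPf r0) andbF.
have hq : v b / v a ^+ j \in integral_pred phi.
  apply: (@integral_root _ (N * l) (r ^+ (M * l - k * j * N))).
    by rewrite muln_gt0 hN.
  rewrite rmorphXn expfB_cond; last by rewrite (negPf r0).
  rewrite expr_div_n exprM vb -exprM; congr (_ / _).
  rewrite -!exprM (_ : (j * (N * l) = l * (j * N))%N) 1?exprM ?va -?exprM; last lia.
  by rewrite mulnA.
exists (RPlus hq); apply: val_inj.
by rewrite rmorphM rmorphXn /= mulrC divfK // expf_neq0.
Qed.

Lemma rplus_idempotent (u : S) : u ^+ 2 = u -> u = 0 \/ u = 1.
Proof.
pose v : {rmorphism S -> L} := val.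
move=> /(congr1 v)/eqP; rewrite rmorphXn -subr_eq0.
have -> : v u ^+ 2 - v u = v u * (v u - 1) by ring.
rewrite mulf_eq0 subr_eq0.
by case/orP=> /eqP h; [left|right]; apply: val_inj;
  rewrite -[LHS]/(v u) h -?(rmorph0 v) -?(rmorph1 v).
Qed.

Lemma rplus_subring_integral (T : comNzRingType) (i : {rmorphism R -> T})
    (j : {rmorphism T -> S}) : injective j -> (forall r, j (i r) = in_rplus phi r) ->
  forall t, exists2 f : {poly R}, f \is monic & root (map_poly i f) t.
Proof.
move=> hj hji t.
have /integral_predP[f hf /rootP hr] := rplus_valP (j t); exists f => //.
pose v : {rmorphism S -> L} := val.
have hv : map_poly v (map_poly j (map_poly i f)) = map_poly (frac_map phi) f.
  by apply/polyP => k; rewrite !coef_map /= hji.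
apply/rootP/hj/val_inj; rewrite rmorph0 -[RHS]hr.
by rewrite -[LHS]/(v _) -!horner_map hv.
Qed.

Lemma ext_seqE (B : comAlgType S) s :
  ext_seq B s = ideal_gen [set` map (in_ralg B) s].
Proof. by rewrite /ext_seq /ext_ideal image_seq. Qed.

End Rplus.

(** Otherwise some [t] is an inverse of [i r] modulo [n]. With [f] an integral equation of [t], the
    element [rho], formally [r^D f(1/r)], maps into [n], yet it is 1 modulo [m] and so a unit. *)
Lemma maximal_ideal_lies_over (R T : comNzRingType) (m : set R) (n : set T)
    (i : {rmorphism R -> T}) :
  adic_complete m -> maximal_ideal m -> maximal_ideal n ->
  (forall t, exists2 f : {poly R}, f \is monic & root (map_poly i f) t) ->
  forall r, m r -> n (i r).
Proof.
move=> hc hmax [hn hn1 hnmax] hint r hr; apply: contrapT => hnr.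
have hm := let: And3 h _ _ := hmax in h.
have [n0 nD nM] := hn; have [m0 mD mM] := hm.
have [nu [t hnu e1]] : [set x | exists a, exists2 b, n a & x = a + b * i r] 1.
  apply: contrapT => h1; apply: hnr; rewrite -(hnmax _ (ideal_adjoin (i r) hn)).
  - by exists 0, 1 => //; ring.
  - by move=> e; apply: h1; rewrite e.
  - by move=> x hx; exists x, 0 => //; ring.
have [f hf /rootP ht] := hint t.
pose D := (size f).-1.
have hD : size f = D.+1 by rewrite prednK // lt0n size_poly_eq0 monic_neq0.
pose rho := \sum_(k < D.+1) f`_k * r ^+ (D - k).
have hrho : n (i rho).
  have -> : i rho = \sum_(k < D.+1) i (f`_k * r ^+ (D - k)) * (1 - (t * i r) ^+ k)
      + i r ^+ D * (map_poly i f).[t].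
    rewrite (horner_coef_wide (n := D.+1)); last by rewrite -hD size_poly.
    rewrite mulr_sumr -big_split rmorph_sum; apply: eq_bigr => k _ /=.
    have -> : i r ^+ D = i r ^+ (D - k) * i r ^+ k by rewrite -exprD subnK // -ltnS.
    by rewrite coef_map rmorphM rmorphXn exprMn /=; ring.
  apply: nD; last by rewrite ht mulr0.
  apply: ideal_sum => // k _; apply: (nM).
  rewrite -opprB subrX1 -mulNr opprB mulrC; apply: (nM).
  by rewrite {1}e1 addrK.
have hrm : ~ m rho.
  move=> h; have [_ + _] := hmax; apply; apply: ideal1 => //.
  have -> : 1 = rho - \sum_(k < D) f`_k * r ^+ (D - k).
    rewrite /rho big_ord_recr /= subnn expr0 mulr1 addrAC subrr add0r.
    by rewrite -[D]/((size f).-1) -/(lead_coef f) (monicP hf).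
  apply: (@idealB _ m) => //; apply: ideal_sum => // k _; apply: (mM).
  by rewrite -(prednK (_ : 0 < D - k)%N) ?subn_gt0 // exprS mulrC; exact: mM.
have [u hu] := complete_local_unit hm hc hmax hrm.
by apply: hn1; apply: ideal1 => //; rewrite -(rmorph1 i) -hu rmorphM; exact: nM.
Qed.

(** * The algebra [C] over [B], then monomials in [T] *)

Theorem corollary6p1
  (R : idomainType) (m : set R) (d p : nat)
  (hloc : local_ring m) (hnoeth : noetherian R) (hcomp : adic_complete m)
  (hmixed : mixed_characteristic R p) (hdim : krull_dim R d)
  (x : seq R) (hx : system_of_parameters m d (p%:R :: x))
  (L : closedFieldType) (phi : {rmorphism {fraction R} -> L})
  (hL : is_alg_closure phi)
  (v : R -> \bar int) (w : rplus phi -> \bar rat)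
  (hv : valuation_extension m v w)
  (ppow : rat -> rplus phi)
  (hppow : forall eps : rat, 0 < eps -> rat_power p%:R eps (ppow eps))
  (B : comAlgType (rplus phi))
  (hB : weakly_almost_CM m d w B)
  (hB1 : ext_seq B (p%:R :: x) <> setT)
  (hB2 : regular_mod (ideal_gen [set p%:R]) (map (in_ralg B) x))
  (hB3 : (forall n : nat, (p%:R : B) ^+ n <> 0) /\
         (forall eps : rat, 0 < eps ->
            forall z : B, z * p%:R = 0 -> ppow eps *: z = 0))
  (hB4 : exists2 eps : rat, 0 < eps & ~ ext_seq B (p%:R :: x) (ppow eps)%:A) :
  (exists (C : comAlgType (rplus phi)) (h : {lrmorphism B -> C}),
     big_CM m (p%:R :: x) C) /\
  (forall (T : comNzRingType) (i : {rmorphism R -> T})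
          (j : {rmorphism T -> rplus phi}),
     injective j -> (forall r, j (i r) = in_rplus phi r) ->
     forall n : set T, maximal_ideal n -> monomial_property n d).
Proof.
have [hmax _] := hloc; have [hsz hrad] := hx.
pose eta (D : comAlgType (rplus phi)) : {rmorphism R -> D} := in_alg D \o in_rplus phi.
have hp0 : p%:R != 0 :> R.
  have [hp hchar _] := hmixed; apply/negP => h.
  by have := hchar p; rewrite !inE hp h.
have hext (D : comAlgType (rplus phi)) r :
    m r -> radical (ideal_gen [set` map (in_ralg D) (p%:R :: x)]) (in_ralg D r).
  by rewrite -hrad => /(radical_map (eta D)).
have [C [h [hCm hCreg]]] : exists (C : comAlgType (rplus phi)) (h : {lrmorphism B -> C}),
    big_CM m (p%:R :: x) C.
  have hpB : in_ralg B p%:R = p%:R by exact: (rmorph_nat (eta B)).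
  pose e k : B := (ppow k.+1%:R^-1)%:A.
  have hk0 k : 0 < k.+1%:R^-1 :> rat by rewrite invr_gt0 ltr0n.
  have [|k|C [f hf]] := @almost_regular_localization B e (map (in_ralg B) (p%:R :: x)).
  - case=> [_ z|k].
      have -> : [set` take 0 (map (in_ralg B) (p%:R :: x))] = set0.
        by apply/seteqP; split.
      rewrite ideal_gen0 => hz n; have [_ h] := hB3.
      rewrite /= mulr_algl; apply: h => //; move: hz => /= <-.
      by rewrite mulrC hpB.
    rewrite /= ltnS => hk z hz n.
    have hE : ideal_gen [set` in_ralg B p%:R :: take k (map (in_ralg B) x)] =
        ideal_gen (ideal_gen [set p%:R] `|` [set` take k (map (in_ralg B) x)]).
      rewrite hpB ideal_genUl; congr ideal_gen; apply/seteqP; split=> u /=.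
        by rewrite inE => /orP[/eqP->|]; [left|right].
      by rewrite inE => -[->|->]; rewrite ?eqxx ?orbT.
    have hI := ideal_gen_ideal [set` in_ralg B p%:R :: take k (map (in_ralg B) x)].
    have [_ _ IM] := hI; apply: (IM).
    by move: hz; rewrite hE; have [_] := hB2; apply.
  - have [eps heps hn] := hB4.
    (* This [N] makes [k / (N + 1)] at most [eps], so [e N ^+ k] divides the chosen power
       [ppow eps]. *)
    pose N := Num.bound (k%:R / eps); exists N => h; apply: hn.
    have [|||q ->] := @rat_power_dvd _ _ phi p%:R (ppow N.+1%:R^-1) (ppow eps) N k eps hp0.
    + by rewrite rmorph_nat; exact: hppow.
    + by rewrite rmorph_nat; exact: hppow.
    + rewrite ler_pdivrMr ?ltr0n // mulrC -ler_pdivrMr //.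
      have h0 : 0 <= k%:R / eps by rewrite divr_ge0 // ltW.
      by apply: (le_trans (ltW (archi_boundP h0))); rewrite ler_nat.
    rewrite ext_seqE -[_%:A]/(in_alg B _) rmorphM rmorphXn mulrC.
    have [_ _ IM] := ideal_gen_ideal [set` map (in_ralg B) (p%:R :: x)].
    exact: IM.
  have [C' [g hg]] := restr_lrmorphism f.
  exists C', g.
  have hreg : regular (map (in_ralg C') (p%:R :: x)).
    have := hg _ hf; rewrite -map_comp (eq_map (g := in_ralg C')) // => r /=.
    by rewrite /in_ralg linearZ /= rmorph1.
  (* Since [m] lands in the radical of the ideal of the parameters, [m] generating the unit ideal
     would make the parameters generate it too. *)
  split=> // h1; have [+ _] := (regularP _).1 hreg; apply.
  apply: ideal1; first exact: ideal_gen_ideal.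
  apply: radical1; have : ext_ideal C' m 1 by rewrite h1.
  apply: ideal_gen_min; first exact: radical_ideal (ideal_gen_ideal _).
  by move=> _ [r hr <-]; exact: hext.
split; first by exists C, h.
move=> T i j hj hji n hn ys [hys hysn] t ht.
have hint := rplus_subring_integral hj hji.
have hmn := maximal_ideal_lies_over hcomp hmax hn hint.
have [hCn hCr] := (regularP _).1 hCreg.
pose kappa : {rmorphism T -> C} := in_alg C \o j.
have hkappa r : kappa (i r) = in_ralg C r by rewrite /kappa /= hji.
have hI := ideal_gen_ideal [set` map (in_ralg C) (p%:R :: x)].
apply: hCn; apply: ideal1 => //; apply: radical1.
have : ideal_gen [set` map kappa ys] 1.
  apply: (regular_monomial (t := t) hCr).
  - by rewrite !size_map hys hsz.
  (* The parameters lie in [m], hence map into [n], the radical of the ideal of [ys]. *)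
  - move=> _ /mapP[r hr ->]; rewrite -hkappa; apply: radical_map.
    by rewrite hysn; apply: hmn; rewrite -hrad; exists 1%N; apply: ideal_gen_sub.
  have -> : [seq y ^+ t.+1 | y <- map kappa ys] = map kappa [seq y ^+ t.+1 | y <- ys].
    by rewrite -!map_comp; apply: eq_map => y; rewrite [RHS](rmorphXn kappa).
  have -> : \prod_(y <- map kappa ys) y ^+ t = kappa (\prod_(y <- ys) y ^+ t).
    by rewrite big_map rmorph_prod; apply: eq_bigr => y _; rewrite rmorphXn.
  exact: ideal_gen_map.
(* It remains to place each [kappa y] in the radical of the ideal of [p, x]: a power of [y] lies in
   [mT] by [integral_nilpotent], and [hext] handles [m]. *)
apply: ideal_gen_min; first exact: radical_ideal.
move=> _ /= /mapP[y hy ->].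
have [f hf hfy] := hint y.
have hy' : n y by rewrite -hysn; exists 1%N; apply: ideal_gen_sub.
have hT (u : T) : u ^+ 2 = u -> u = 0 \/ u = 1.
  move=> hu; have [|h0|h1] := @rplus_idempotent _ _ phi (j u).
  - by rewrite -rmorphXn hu.
  - by left; apply: hj; rewrite h0 rmorph0.
  - by right; apply: hj; rewrite h1 rmorph1.
have [hn0 hn1 _] := hn.
have [N hN] := integral_nilpotent hcomp hmax hT hn0 hn1 hmn hf hfy hy'.
set J := radical _.
have hJ : is_ideal (kappa @^-1` J) by exact: ideal_preimage (radical_ideal hI).
have hN' : (kappa @^-1` J) (y ^+ N).
  apply: ideal_gen_min hJ _ _ hN => _ [r hr <-].
  by rewrite /preimage /mkset hkappa; exact: hext.
by apply: (@radicalX _ _ _ N); rewrite -rmorphXn.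
Qed.
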